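(* Suppose $\widetilde U=(\widetilde U_1,\widetilde U_2)$ and $\widehat U=(\widehat U_1,\widehat U_2)$ are ordered upper and lower solutions (nonincreasing case) of the scheme (NDS), and suppose that for every $m\ge1$, every $p\in\overline\Omega^h$, every $\alpha\neq\alpha'$ in $\{1,2\}$ and every $u\in\mathbb R^2$ with $\widehat U(p,t_m)\le u\le\widetilde U(p,t_m)$, $$\frac{\partial f_\alpha(p,t_m,u)}{\partial u_\alpha}\le c_\alpha(p,t_m),\qquad -\frac{\partial f_\alpha(p,t_m,u)}{\partial u_{\alpha'}}\le0,$$ where $c_\alpha$ are nonnegative bounded functions. Let $\eta=0$ (block Jacobi) or $\eta=1$ (block Gauss--Seidel), and let $\{\overline U^{(n)}_{1,i,m},\underline U^{(n)}_{2,i,m}\}$ and $\{\underline U^{(n)}_{1,i,m},\overline U^{(n)}_{2,i,m}\}$ be the sequences generated by the coupled block iterative method with $\overline U^{(0)}(p,t_m)=\widetilde U(p,t_m)$ and $\underline U^{(0)}(p,t_m)=\widehat U(p,t_m)$. Then the iterates are ordered upper and lower solutions, i.e. for all $n\ge1$, $m\ge1$, $\alpha\ne\alpha'$, and $1\le i\le N_x-1$, $$\mathcal G_{\alpha,i,m}\big(\overline U^{(n)}_{\alpha,i,m},\overline U_{\alpha,i,m-1},\underline U^{(n)}_{\alpha',i,m}\big)\ge\mathbf 0,\qquad \mathcal G_{\alpha,i,m}\big(\underline U^{(n)}_{\alpha,i,m},\underline U_{\alpha,i,m-1},\overline U^{(n)}_{\alpha',i,m}\big)\le\mathbf 0$$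 together with $\underline U^{(n)}_{\alpha,i,m}\le\overline U^{(n)}_{\alpha,i,m}$ for $0\le i\le N_x$; and the sequences converge monotonically (as $n\to\infty$, on each time level), with, for all $n\ge1$, $$\underline U^{(n-1)}_{\alpha,i,m}\le\underline U^{(n)}_{\alpha,i,m}\le\overline U^{(n)}_{\alpha,i,m}\le\overline U^{(n-1)}_{\alpha,i,m},\qquad i=0,1,\dots,N_x,\ \alpha=1,2,\ m\ge1.$$
   Context: Data: $l_1,l_2,T>0$, $\omega=(0,l_1)\times(0,l_2)$, $Q_T=\omega\times(0,T]$, $\partial Q_T=\partial\omega\times(0,T]$; for $\alpha=1,2$: constants $\varepsilon_\alpha>0$, smooth functions $f_\alpha(x,y,t,u)$, $u=(u_1,u_2)$, $g_\alpha$ on $\partial Q_T$, $\psi_\alpha$ on $\overline\omega$, and smooth nonnegative $v_{\alpha,1},v_{\alpha,2}$ on $\overline Q_T$. Vector inequalities are componentwise; $\alpha'$ denotes the index in $\{1,2\}$ different from $\alpha$. Convention: $f_\alpha(p,t_m,a_\alpha,b_{\alpha'})$ is the value of $f_\alpha$ when $u_\alpha=a_\alpha$ and $u_{\alpha'}=b_{\alpha'}$. Mesh: $x_i=ih_x$ ($0\le i\le N_x$, $h_x=l_1/N_x$), $y_j=jh_y$ ($0\le j\le N_y$, $h_y=l_2/N_y$), $t_m=m\tau$ ($0\le m\le N_\tau$, $\tau=T/N_\tau$). $\overline\Omega^h$ is the set of all $p=(x_i,y_j)$, $\Omega^h$ the interior ones, $\partial\Omega^h=\overline\Omega^h\setminus\Omega^h$.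 ''$m\ge1$'' means $1\le m\le N_\tau$. Write $U_{\alpha,ij,m}=U_\alpha(x_i,y_j,t_m)$. Operator: $\mathcal L^h_\alpha U_\alpha=-\varepsilon_\alpha(D_x^2U_\alpha+D_y^2U_\alpha)+v_{\alpha,1}D_x^1U_\alpha+v_{\alpha,2}D_y^1U_\alpha$, with $D_x^2,D_y^2$ the standard second central differences and $D_x^1,D_y^1$ the backward differences, e.g. $D^1_xU_{\alpha,ij,m}=(U_{\alpha,ij,m}-U_{\alpha,i-1,j,m})/h_x$. Scheme (NDS): for $\alpha=1,2$, $m\ge1$, $(\mathcal L^h_\alpha(p,t_m)+\tau^{-1})U_\alpha(p,t_m)+f_\alpha(p,t_m,U)-\tau^{-1}U_\alpha(p,t_{m-1})=0$ for $p\in\Omega^h$; $U(p,t_m)=g(p,t_m)$ for $p\in\partial\Omega^h$; $U(p,0)=\psi(p)$ for $p\in\overline\Omega^h$. Ordered upper and lower solutions (nonincreasing case): $\widetilde U,\widehat U$ are such if, for all $m\ge1$ and $\alpha\ne\alpha'$: $\widetilde U\ge\widehat U$ on $\overline\Omega^h$; on $\Omega^h$, $(\mathcal L^h_\alpha+\tau^{-1})\widetilde U_\alpha(p,t_m)+f_\alpha(p,t_m,\widetilde U_\alpha,\widehat U_{\alpha'})-\tau^{-1}\widetilde U_\alpha(p,t_{m-1})\ge0$ and $(\mathcal L^h_\alpha+\tau^{-1})\widehat U_\alpha(p,t_m)+f_\alpha(p,t_m,\widehat U_\alpha,\widetilde U_{\alpha'})-\tau^{-1}\widehat U_\alpha(p,t_{m-1})\le0$;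 $\widehat U\le g\le\widetilde U$ on $\partial\Omega^h$; and $\widehat U(p,0)\le\psi(p)\le\widetilde U(p,0)$ on $\overline\Omega^h$. Block form: $l_{\alpha,ij,m}=\varepsilon_\alpha h_x^{-2}+v_{\alpha,1}(x_i,y_j,t_m)h_x^{-1}$, $r_{\alpha,ij,m}=\varepsilon_\alpha h_x^{-2}$, $b_{\alpha,ij,m}=\varepsilon_\alpha h_y^{-2}+v_{\alpha,2}(x_i,y_j,t_m)h_y^{-1}$, $t_{\alpha,ij,m}=\varepsilon_\alpha h_y^{-2}$, $d_{\alpha,ij,m}=\tau^{-1}+l_{\alpha,ij,m}+r_{\alpha,ij,m}+b_{\alpha,ij,m}+t_{\alpha,ij,m}$. Put $U_{\alpha,i,m}=(U_{\alpha,i,1,m},\dots,U_{\alpha,i,N_y-1,m})^T$ for $0\le i\le N_x$, and define $g_{\alpha,i,m}$ ($i=0,N_x$), $\psi_{\alpha,i}$ likewise. $L_{\alpha,i,m},R_{\alpha,i,m}$ are the diagonal matrices with entries $l_{\alpha,ij,m}$, $r_{\alpha,ij,m}$, $1\le j\le N_y-1$; $A_{\alpha,i,m}$ is the tridiagonal matrix with diagonal entries $d_{\alpha,ij,m}$, subdiagonal entries $-b_{\alpha,ij,m}$ and superdiagonal entries $-t_{\alpha,ij,m}$ in row $j$; $F_{\alpha,i,m}(U_{\alpha,i,m},U_{\alpha',i,m})$ is the vector with entries $f_\alpha(x_i,y_j,t_m,U_{\alpha,ij,m},U_{\alpha',ij,m})$ (the value of $f_\alpha$ at $(x_i,y_j,t_m)$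 when $u_\alpha=U_{\alpha,ij,m}$ and $u_{\alpha'}=U_{\alpha',ij,m}$); $G^*_{\alpha,i,m}$ is the vector collecting the contributions of the boundary values at $j=0,N_y$: it has $-b_{\alpha,i1,m}g_\alpha(x_i,y_0,t_m)$ added in its first entry, $-t_{\alpha,i,N_y-1,m}g_\alpha(x_i,y_{N_y},t_m)$ added in its last entry, and is zero otherwise. For $1\le i\le N_x-1$ the residual is $$\mathcal G_{\alpha,i,m}(U_{\alpha,i,m},U_{\alpha,i,m-1},U_{\alpha',i,m})=A_{\alpha,i,m}U_{\alpha,i,m}-L_{\alpha,i,m}U_{\alpha,i-1,m}-R_{\alpha,i,m}U_{\alpha,i+1,m}+F_{\alpha,i,m}(U_{\alpha,i,m},U_{\alpha',i,m})-\tau^{-1}U_{\alpha,i,m-1}+G^*_{\alpha,i,m}.$$ Coupled block iterative method: $c_{\alpha,m}=\max_{p\in\overline\Omega^h}c_\alpha(p,t_m)$. On each level $m\ge1$ and for $n\ge1$, $\overline U^{(n)}=\overline U^{(n-1)}+\overline Z^{(n)}$, $\underline U^{(n)}=\underline U^{(n-1)}+\underline Z^{(n)}$. The sequence $\{\overline U_1^{(n)},\underline U_2^{(n)}\}$ is given, for $1\le i\le N_x-1$, by $$A_{1,i,m}\overline Z^{(n)}_{1,i,m}-\eta L_{1,i,m}\overline Z^{(n)}_{1,i-1,m}+c_{1,m}\overline Z^{(n)}_{1,i,m}=-\mathcal G_{1,i,m}\big(\overline U^{(n-1)}_{1,i,m},\overline U_{1,i,m-1},\underline U^{(n-1)}_{2,i,m}\big),$$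 $$A_{2,i,m}\underline Z^{(n)}_{2,i,m}-\eta L_{2,i,m}\underline Z^{(n)}_{2,i-1,m}+c_{2,m}\underline Z^{(n)}_{2,i,m}=-\mathcal G_{2,i,m}\big(\underline U^{(n-1)}_{2,i,m},\underline U_{2,i,m-1},\overline U^{(n-1)}_{1,i,m}\big),$$ and $\{\underline U_1^{(n)},\overline U_2^{(n)}\}$ by the same formulas with overlines and underlines interchanged. For $i=0,N_x$: $Z^{(1)}_{\alpha,i,m}=g_{\alpha,i,m}-U^{(0)}_{\alpha,i,m}$, $Z^{(n)}_{\alpha,i,m}=\mathbf 0$ for $n\ge2$ (for each of the overlined and underlined quantities). On level $0$, $\overline U_{\alpha,i,0}=\underline U_{\alpha,i,0}=\psi_{\alpha,i}$; for $m\ge1$, $\overline U_{\alpha,i,m}=\overline U^{(n_m)}_{\alpha,i,m}$, $\underline U_{\alpha,i,m}=\underline U^{(n_m)}_{\alpha,i,m}$ are the approximate solutions on level $m$, $n_m\ge1$ being the number of iterations performed on level $m$. *)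

(* Defs.v *)
From mathcomp Require Import all_boot all_order all_algebra.
From mathcomp Require Import all_classical all_reals all_analysis.
Import Order.TTheory GRing.Theory Num.Theory.
Import numFieldNormedType.Exports.

Set Implicit Arguments.
Unset Strict Implicit.
Unset Printing Implicit Defensive.

Local Open Scope classical_set_scope.
Local Open Scope ring_scope.

(* [Ck k U F]: all iterated directional derivatives of [F] of order at most [k]
   exist and are continuous on the open set [U].  On a finite-dimensional [E]
   (the only use below) this is the usual class C^k, since directional
   derivatives of a C^k function are combinations of the partial ones. *)
Fixpoint Ck (R : realType) (E : normedModType R) (k : nat) (U : set E)
    (F : E -> R) : Prop :=
  (forall a, U a -> {for a, continuous F}) /\
  match k with
  | 0 => True
  | k'.+1 => forall w : E,
      (forall a, U a -> derivable F a w) /\ Ck k' U (fun a => 'D_w F a)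
  end.

(* Smoothness on an arbitrary (not necessarily open) set [A]: locally, [F] is
   the restriction to [A] of a C^infinity function on an open set.  The values
   of [F] outside [A] are irrelevant. *)
Definition smooth_on (R : realType) (E : normedModType R) (A : set E)
    (F : E -> R) : Prop :=
  forall a, A a -> exists (U : set E) (G : E -> R),
    [/\ open U, U a, forall k, Ck k U G &
        forall z, A z -> U z -> F z = G z].

Section Domains.
Variables (R : realType) (l1 l2 T : R).

Definition omega_bar : set (R * R) :=
  [set p | 0 <= p.1 <= l1 /\ 0 <= p.2 <= l2].

Definition omega_bnd : set (R * R) :=
  [set p | omega_bar p /\ [\/ p.1 = 0, p.1 = l1, p.2 = 0 | p.2 = l2]].

Definition QT_bar : set (R * R * R) :=
  [set z | omega_bar z.1 /\ 0 <= z.2 <= T].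

Definition QT_bnd : set (R * R * R) :=
  [set z | omega_bnd z.1 /\ 0 < z.2 <= T].

Definition QT_bar_R2 : set (R * R * R * 'rV[R]_2) := [set z | QT_bar z.1].

End Domains.

(* The index alpha in {1,2} is an element of 'I_2.  A point of the domain of
   [f alpha] is (p, t, u) with p = (x, y) and u = (u_1, u_2) a row vector. *)
Record problem (R : realType) := Problem {
  l1 : R; l2 : R; T : R;
  Nx : nat; Ny : nat; Nt : nat;
  eps : 'I_2 -> R;
  f : 'I_2 -> R * R * R * 'rV[R]_2 -> R;
  g : 'I_2 -> R * R * R -> R;
  psi : 'I_2 -> R * R -> R;
  v1 : 'I_2 -> R * R * R -> R;
  v2 : 'I_2 -> R * R * R -> R;
  l1_gt0 : 0 < l1; l2_gt0 : 0 < l2; T_gt0 : 0 < T;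
  Nx_gt0 : (0 < Nx)%N; Ny_gt0 : (0 < Ny)%N; Nt_gt0 : (0 < Nt)%N;
  eps_gt0 : forall alpha, 0 < eps alpha;
  f_smooth : forall alpha, smooth_on (QT_bar_R2 l1 l2 T) (f alpha);
  g_smooth : forall alpha, smooth_on (QT_bnd l1 l2 T) (g alpha);
  psi_smooth : forall alpha, smooth_on (omega_bar l1 l2) (psi alpha);
  v1_smooth : forall alpha, smooth_on (QT_bar l1 l2 T) (v1 alpha);
  v2_smooth : forall alpha, smooth_on (QT_bar l1 l2 T) (v2 alpha);
  v1_ge0 : forall alpha z, QT_bar l1 l2 T z -> 0 <= v1 alpha z;
  v2_ge0 : forall alpha z, QT_bar l1 l2 T z -> 0 <= v2 alpha z
}.

(* [V alpha i j m] is the value of V_alpha at (x_i, y_j, t_m); only the indices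
   i <= Nx, j <= Ny, m <= Nt are meaningful. *)
Definition mesh_fun (R : realType) := 'I_2 -> nat -> nat -> nat -> R.

(* The vector u in R^2 with u_alpha = a and all other entries equal to b. *)
Definition uvec (R : realType) (alpha : 'I_2) (a b : R) : 'rV[R]_2 :=
  \row_beta (if beta == alpha then a else b).

Section Scheme.
Variables (R : realType) (D : problem R).

Definition hx : R := l1 D / (Nx D)%:R.
Definition hy : R := l2 D / (Ny D)%:R.
Definition tau : R := T D / (Nt D)%:R.

Definition pt (i j : nat) : R * R := (i%:R * hx, j%:R * hy).
Definition tm (m : nat) : R := m%:R * tau.

Definition in_mesh (i j : nat) : bool := (i <= Nx D)%N && (j <= Ny D)%N.
Definition in_interior (i j : nat) : bool :=
  (0 < i < Nx D)%N && (0 < j < Ny D)%N.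
Definition on_boundary (i j : nat) : bool := in_mesh i j && ~~ in_interior i j.
Definition time_level (m : nat) : bool := (1 <= m <= Nt D)%N.

Definition Dxx (V : nat -> nat -> R) i j : R :=
  (V i.-1 j - 2 * V i j + V i.+1 j) / hx ^+ 2.
Definition Dyy (V : nat -> nat -> R) i j : R :=
  (V i j.-1 - 2 * V i j + V i j.+1) / hy ^+ 2.
Definition Dx (V : nat -> nat -> R) i j : R := (V i j - V i.-1 j) / hx.
Definition Dy (V : nat -> nat -> R) i j : R := (V i j - V i j.-1) / hy.

Definition Lh (alpha : 'I_2) (i j m : nat) (V : nat -> nat -> R) : R :=
  - eps D alpha * (Dxx V i j + Dyy V i j)
  + v1 D alpha (pt i j, tm m) * Dx V i j
  + v2 D alpha (pt i j, tm m) * Dy V i j.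

(* Left-hand side of the alpha-th equation of the nonlinear difference scheme
   at (x_i, y_j, t_m), with u_alpha taken from [V] and u_alpha' from [W]. *)
Definition scheme_lhs (alpha alpha' : 'I_2) (i j m : nat) (V W : mesh_fun R)
    : R :=
  Lh alpha i j m (fun k l => V alpha k l m) + tau^-1 * V alpha i j m
  + f D alpha (pt i j, tm m, uvec alpha (V alpha i j m) (W alpha' i j m))
  - tau^-1 * V alpha i j m.-1.

Definition ordered_upper_lower (Ut Uh : mesh_fun R) : Prop :=
  [/\ forall alpha i j m, time_level m -> in_mesh i j ->
        Uh alpha i j m <= Ut alpha i j m,
      forall alpha alpha' i j m, alpha != alpha' -> time_level m ->
        in_interior i j ->
        0 <= scheme_lhs alpha alpha' i j m Ut Uh /\
        scheme_lhs alpha alpha' i j m Uh Ut <= 0,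
      forall alpha i j m, time_level m -> on_boundary i j ->
        Uh alpha i j m <= g D alpha (pt i j, tm m) <= Ut alpha i j m &
      forall alpha i j, in_mesh i j ->
        Uh alpha i j 0%N <= psi D alpha (pt i j) <= Ut alpha i j 0%N].

Definition df (alpha beta : 'I_2) (z : R * R * R) (u : 'rV[R]_2) : R :=
  'D_(delta_mx 0 beta) (fun w : 'rV[R]_2 => f D alpha (z, w)) u.

Definition lcoef alpha i j m : R :=
  eps D alpha / hx ^+ 2 + v1 D alpha (pt i j, tm m) / hx.
Definition rcoef (alpha : 'I_2) (i j m : nat) : R := eps D alpha / hx ^+ 2.
Definition bcoef alpha i j m : R :=
  eps D alpha / hy ^+ 2 + v2 D alpha (pt i j, tm m) / hy.
Definition tcoef (alpha : 'I_2) (i j m : nat) : R := eps D alpha / hy ^+ 2.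
Definition dcoef alpha i j m : R :=
  tau^-1 + lcoef alpha i j m + rcoef alpha i j m
  + bcoef alpha i j m + tcoef alpha i j m.

(* Block vectors hold the values at y_1, ..., y_(Ny-1): the entry of index
   k : 'I_(Ny-1) corresponds to j = k + 1. *)
Definition blockvec := 'cV[R]_((Ny D).-1).

Definition lev (V W : blockvec) : Prop := forall k, V k 0 <= W k 0.

Definition block (V : mesh_fun R) alpha i m : blockvec :=
  \col_k V alpha i k.+1 m.
Definition gblock alpha i m : blockvec := \col_k g D alpha (pt i k.+1, tm m).
Definition psiblock alpha i : blockvec := \col_k psi D alpha (pt i k.+1).

Definition Lmx alpha i m : 'M[R]_((Ny D).-1) :=
  diag_mx (\row_k lcoef alpha i k.+1 m).
Definition Rmx alpha i m : 'M[R]_((Ny D).-1) :=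
  diag_mx (\row_k rcoef alpha i k.+1 m).
Definition Amx alpha i m : 'M[R]_((Ny D).-1) :=
  \matrix_(k, k') (if k == k' then dcoef alpha i k.+1 m
                   else if (k == k'.+1 :> nat) then - bcoef alpha i k.+1 m
                   else if (k.+1 == k' :> nat) then - tcoef alpha i k.+1 m
                   else 0).

Definition Fvec alpha i m (V W : blockvec) : blockvec :=
  \col_k f D alpha (pt i k.+1, tm m, uvec alpha (V k 0) (W k 0)).

(* When Ny = 2 the first and last entries coincide and both terms are added. *)
Definition Gstar alpha i m : blockvec :=
  \col_k ((if k.+1 == 1%N
           then - bcoef alpha i 1%N m * g D alpha (pt i 0%N, tm m) else 0)
        + (if k.+1 == (Ny D).-1
           then - tcoef alpha i (Ny D).-1 m * g D alpha (pt i (Ny D), tm m)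
           else 0)).

(* [V] is the whole family i |-> U_{alpha,i,m}, as the residual on the i-th line
   also involves the lines i-1 and i+1. *)
Definition residual alpha i m (V : nat -> blockvec) (Vprev W : blockvec)
    : blockvec :=
  Amx alpha i m *m V i - Lmx alpha i m *m V i.-1 - Rmx alpha i m *m V i.+1
  + Fvec alpha i m (V i) W - tau^-1 *: Vprev + Gstar alpha i m.

(* Maximum over all mesh points; the default value is itself one of the values
   being compared. *)
Definition cmax (c : mesh_fun R) alpha m : R :=
  \big[Num.max/c alpha 0%N 0%N m]_(i < (Nx D).+1)
    \big[Num.max/c alpha 0%N 0%N m]_(j < (Ny D).+1) c alpha i j m.

(* [V alpha i m n] is the n-th iterate for U_{alpha,i,m}. *)
Definition iterates := 'I_2 -> nat -> nat -> nat -> blockvec.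

(* Approximate solution on level m, after [nit m] iterations if m >= 1. *)
Definition level_sol (nit : nat -> nat) (V : iterates) alpha i m : blockvec :=
  if m is 0 then psiblock alpha i else V alpha i m (nit m).

(* The component V_alpha is iterated, with increments Z_alpha, against the
   component W_alpha' of the companion family. *)
Definition block_iteration (c : mesh_fun R) (eta : R) (nit : nat -> nat)
    (alpha alpha' : 'I_2) (V Z W : iterates) : Prop :=
  forall m n, time_level m -> (1 <= n)%N ->
  [/\ forall i, (i <= Nx D)%N ->
        V alpha i m n = V alpha i m n.-1 + Z alpha i m n,
      forall i, (0 < i < Nx D)%N ->
        Amx alpha i m *m Z alpha i m n
        - eta *: (Lmx alpha i m *m Z alpha i.-1 m n)
        + cmax c alpha m *: Z alpha i m n
        = - residual alpha i m (fun k => V alpha k m n.-1)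
              (level_sol nit V alpha i m.-1) (W alpha' i m n.-1) &
      forall i, i = 0%N \/ i = Nx D ->
        Z alpha i m n =
          if n == 1%N then gblock alpha i m - V alpha i m 0%N else 0].

Definition coupled_block_method (c : mesh_fun R) (eta : R) (nit : nat -> nat)
    (Ubar Zbar Ulow Zlow : iterates) : Prop :=
  forall alpha alpha', alpha != alpha' ->
    block_iteration c eta nit alpha alpha' Ubar Zbar Ulow /\
    block_iteration c eta nit alpha alpha' Ulow Zlow Ubar.

End Scheme.

(* Main.v *)
Require Import Defs.
From mathcomp Require Import all_boot all_order all_algebra.
From mathcomp Require Import all_classical all_reals all_analysis.
From mathcomp Require Import ring lra zify.
Import Order.TTheory GRing.Theory Num.Theory.
Import numFieldNormedType.Exports.

Set Implicit Arguments.
Unset Strict Implicit.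
Unset Printing Implicit Defensive.

Local Open Scope classical_set_scope.
Local Open Scope ring_scope.

(** One sweep of the method is a linear system for the corrections Z on the
    grid lines x = x_i, with blocks A_i + c I on the diagonal and, for block
    Gauss-Seidel, -L_i below it.  Each A_i + c I is tridiagonal with
    nonpositive off-diagonal entries and positive row sums, so it has a
    nonnegative inverse ([Mmatrix_inverse_positive]); marching from line to
    line, a family whose sweep is nonnegative and which is nonnegative on the
    two boundary lines is itself nonnegative ([sweep_ge0]).  Monotonicity and
    ordering of the iterates both follow from this principle.

    The nonlinearity enters through a single inequality.  In the sector between
    the lower and the upper solution, f_alpha grows in u_alpha at rate at most c
    and is nondecreasing in the other variable, so by the mean value theorem
    f(a', b') - f(a, b) <= c (a' - a) whenever a <= a' and b' <= b
    ([f_increment_le]).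

    On a time level, suppose that the n-th iterates lie in the sector and that
    their residuals have the signs of upper and lower solutions.
    - The sweeps of the corrections are minus the residuals, so the upper
      iterate decreases and the lower one increases ([corrections_monotone]).
    - The sweep of the gap between the two new iterates equals
      c W_i + (1 - eta) L W_(i-1) + R W_(i+1) minus a reaction increment plus
      the gap of the previous time level over tau, W being the old gap; it is
      nonnegative by the inequality above, so the new iterates stay ordered
      ([iterates_ordered]).
    - The new residual equals
      - c Z_i - (1 - eta) L Z_(i-1) - R Z_(i+1) plus a reaction increment
      ([residual_after_sweep]), and the same inequality gives it the sign of
      - Z ([residual_signs_step]).

    This is an induction on n within a level, and the sandwich that it yields
    for the approximate solution of one level starts the induction on the next
    one.  Convergence is that of bounded monotone sequences, entry by entry. *)

(** * Increments of functions along a line *)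

Lemma is_derive_along_line (R : realType) (E : normedModType R) (h : E -> R)
    (u e : E) (s : R) :
  derivable h (u + s *: e) e ->
  is_derive s 1 (fun t : R => h (u + t *: e)) ('D_e h (u + s *: e)).
Proof.
have quotE : (fun d : R => d^-1 *: (((fun t : R => h (u + t *: e)) \o shift s)
      (d *: 1) - h (u + s *: e)))
    = (fun d : R => d^-1 *: ((h \o shift (u + s *: e)) (d *: e)
      - h (u + s *: e))).
  apply/funext => d /=; congr (_ *: (h _ - _)).
  by rewrite [d *: 1]mulr1 scalerDl addrCA.
by move=> dh; split; rewrite /derivable /derive quotE.
Qed.

(** The mean value theorem for the restriction of [h] to the segment; only the
    directional derivative along that segment is involved. *)
Lemma le_increment_along_line (R : realType) (E : normedModType R) (h : E -> R)
    (u e : E) (delta M : R) :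
  0 <= delta ->
  (forall s, 0 <= s <= delta ->
     derivable h (u + s *: e) e /\ 'D_e h (u + s *: e) <= M) ->
  h (u + delta *: e) - h u <= M * delta.
Proof.
move=> delta0 dh.
pose phi (t : R) : R := h (u + t *: e).
pose dphi (s : R) : R := 'D_e h (u + s *: e).
have phi' s : s \in `[0, delta] -> is_derive s 1 phi (dphi s).
  by rewrite in_itv /= => /dh[dhs _]; exact: is_derive_along_line.
have phi_cont : {within `[0, delta], continuous phi}.
  by apply: derivable_within_continuous => s /phi'[].
have phi_oo s : s \in `]0, delta[ -> is_derive s 1 phi (dphi s).
  by move=> /subset_itv_oo_cc /phi'.
have [s s_in] := @MVT_segment R phi dphi 0 delta delta0 phi_oo phi_cont.
rewrite /phi scale0r addr0 subr0 => ->; rewrite ler_wpM2r//.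
by move: s_in; rewrite in_itv /= => /dh[].
Qed.

(** * M-matrices and convergence of matrices *)

(** Discrete minimum principle.  At an index [k] where [x] is minimal,
    (A x)_k = sum_j A_kj (x_j - x_k) + (row sum) x_k; the sum is nonpositive,
    so a negative x_k would make (A x)_k negative.  The row sums are written as
    [A *m const_mx 1], so that a product formula for [A] also computes them. *)
Lemma Mmatrix_inverse_positive (R : realFieldType) (n : nat) (A : 'M[R]_n)
    (x : 'cV[R]_n) :
  (forall k k', k != k' -> A k k' <= 0) ->
  (forall k, 0 < (A *m const_mx 1 : 'cV[R]_n) k 0) ->
  (forall k, 0 <= (A *m x) k 0) ->
  forall k, 0 <= x k 0.
Proof.
move=> offdiag rowsum Ax0 k0.
have [k _ kmin] := @arg_minP _ R _ k0 xpredT (fun k => x k 0) isT.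
apply: (le_trans _ (kmin k0 isT)); rewrite leNgt; apply/negP => xk_lt0.
have := Ax0 k; apply/negP; rewrite -ltNge.
have -> : (A *m x) k 0 =
    \sum_j A k j * (x j 0 - x k 0) + (A *m const_mx 1 : 'cV[R]_n) k 0 * x k 0.
  rewrite !mxE mulr_suml -big_split /=; apply: eq_bigr => j _.
  by rewrite !mxE mulr1 mulrBr subrK.
rewrite -[ltRHS]addr0 ler_ltD ?nmulr_llt0//; apply: sumr_le0 => j _.
have [<-|kj] := eqVneq k j; first by rewrite subrr mulr0.
by rewrite mulr_le0_ge0 ?offdiag ?subr_ge0 ?kmin.
Qed.

Lemma is_cvgn_mx (R : realType) (p q : nat) (V : nat -> 'M[R]_(p, q)) :
  (forall i j, cvgn (fun n => V n i j)) -> cvgn V.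
Proof.
move=> cvV; apply/cvg_ex; exists (\matrix_(i, j) limn (fun n => V n i j)).
apply/cvg_ballP => e e0.
have near_entry (ij : 'I_p * 'I_q) :
    \forall n \near \oo, ball (limn (fun n => V n ij.1 ij.2)) e (V n ij.1 ij.2).
  by move/cvg_ballP : (cvV ij.1 ij.2); exact.
near=> n.
suff : forall ij : 'I_p * 'I_q,
    ball (limn (fun n => V n ij.1 ij.2)) e (V n ij.1 ij.2).
  by move=> close; split=> // i j; rewrite mxE; exact: (close (i, j)).
by near: n; apply: filter_forall; exact: near_entry.
Unshelve. all: by end_near. Qed.

(** * The reaction terms in the sector *)

(** Smoothness on [A] times the whole space [F] gives derivatives in the
    directions of [F] at every point, including those above the boundary of
    [A]: there [h] agrees with its local smooth extension on a full
    neighbourhood within the fibre. *)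
Lemma smooth_on_fst_derivable (R : realType) (E F : normedModType R)
    (A : set E) (h : E * F -> R) (z : E) (u e : F) :
  smooth_on [set x | A x.1] h -> A z -> derivable (fun w => h (z, w)) u e.
Proof.
move=> h_smooth Az.
have [U [G [U_open Uzu GCk hG]]] := h_smooth (z, u) Az.
have [_ /(_ (0, e))[/(_ _ Uzu) dG _]] := GCk 1.
have quotE : (fun d : R =>
      d^-1 *: ((G \o shift (z, u)) (d *: (0, e)) - G (z, u)))
    = (fun d : R => d^-1 *: (((fun w => G (z, w)) \o shift u) (d *: e)
        - G (z, u))).
  apply/funext => d /=; congr (_ *: (G _ - _)).
  by apply/pair_equal_spec; split; rewrite /= ?scaler0 ?add0r.
have {quotE} dG : derivable (fun w => G (z, w)) u e.
  by move: dG; rewrite /derivable quotE.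
apply: near_eq_derivable dG.
have : \forall w \near u, U (z, w).
  have zC : {for u, continuous (fun w : F => (z, w))}.
    by apply: cvg_pair => /=; [exact: cvg_cst | exact: cvg_id].
  by apply: zC; exact: open_nbhs_nbhs.
by apply: filterS => w Uzw; rewrite hG.
Qed.

Section Scheme.
Variables (R : realType) (D : problem R).
Implicit Types (alpha beta : 'I_2) (i j m n : nat).
Implicit Types (V Z : nat -> blockvec D) (P W : blockvec D).
Local Notation N := ((Ny D).-1).

Lemma hx_gt0 : 0 < hx D.
Proof. by rewrite divr_gt0 ?l1_gt0// ltr0n Nx_gt0. Qed.

Lemma hy_gt0 : 0 < hy D.
Proof. by rewrite divr_gt0 ?l2_gt0// ltr0n Ny_gt0. Qed.

Lemma tau_gt0 : 0 < tau D.
Proof. by rewrite divr_gt0 ?T_gt0// ltr0n Nt_gt0. Qed.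

Lemma mesh_coord_bounds (L : R) (q k : nat) :
  0 < L -> (0 < q)%N -> (k <= q)%N -> 0 <= k%:R * (L / q%:R) <= L.
Proof.
move=> L0 q0 kq; apply/andP; split.
  by rewrite mulr_ge0// divr_ge0// ltW.
rewrite mulrCA -[leRHS]mulr1 ler_pM2l// ler_pdivrMr ?ltr0n//.
by rewrite mul1r ler_nat.
Qed.

Lemma mesh_QT_bar i j m : in_mesh D i j -> (m <= Nt D)%N ->
  QT_bar (l1 D) (l2 D) (T D) (pt D i j, tm D m).
Proof.
move=> /andP[iN jN] mN; split => /=; last first.
  by apply: mesh_coord_bounds; rewrite ?T_gt0 ?Nt_gt0.
by split; apply: mesh_coord_bounds;
  rewrite ?l1_gt0 ?l2_gt0 ?Nx_gt0 ?Ny_gt0.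
Qed.

Lemma f_derivable alpha (u e : 'rV[R]_2) i j m :
  in_mesh D i j -> (m <= Nt D)%N ->
  derivable (fun w : 'rV[R]_2 => f D alpha (pt D i j, tm D m, w)) u e.
Proof.
move=> ij mN; apply: (@smooth_on_fst_derivable _ _ _
  (QT_bar (l1 D) (l2 D) (T D))); last exact: mesh_QT_bar.
exact: f_smooth.
Qed.

Lemma le_cmax (c : mesh_fun R) alpha i j m : in_mesh D i j ->
  c alpha i j m <= cmax D c alpha m.
Proof.
case/andP=> iN jN; rewrite -ltnS in iN; rewrite -ltnS in jN; rewrite /cmax.
apply/bigmax_geP; right; exists (Ordinal iN) => //.
by apply/bigmax_geP; right; exists (Ordinal jN).
Qed.

Lemma index2_cases alpha alpha' beta : alpha != alpha' ->
  beta = alpha \/ beta = alpha'.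
Proof.
move: alpha alpha' beta => [[|[|//]] ?] [[|[|//]] ?] [[|[|//]] ?] //= _;
  (by left; apply: val_inj) || (by right; apply: val_inj).
Qed.

Lemma uvec_own alpha (a b s : R) :
  uvec alpha a b + s *: delta_mx 0 alpha = uvec alpha (a + s) b.
Proof.
apply/rowP => beta; rewrite !mxE eqxx /=.
by case: eqP => _; rewrite ?mulr1 ?mulr0 ?addr0.
Qed.

Lemma uvec_other alpha alpha' (a b s : R) : alpha != alpha' ->
  uvec alpha a b + s *: delta_mx 0 alpha' = uvec alpha a (b + s).
Proof.
move=> alphaN; apply/rowP => beta; rewrite !mxE eqxx /=.
have [->|->] := index2_cases beta alphaN.
  by rewrite eqxx (negbTE alphaN) mulr0 addr0.
by rewrite eqxx eq_sym (negbTE alphaN) mulr1.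
Qed.

(** Going from (a, b) to (a', b') changes the two arguments in opposite
    directions.  The sector is a product of intervals, so the path through
    (a, b') stays inside; lowering the other argument cannot increase [f], and
    raising the own argument adds at most K (a' - a). *)
Lemma f_increment_le (Util Uhat : mesh_fun R) (K : R) alpha alpha' i j m
    (a a' b b' : R) :
  alpha != alpha' -> time_level D m -> in_mesh D i j ->
  (forall u : 'rV[R]_2,
     (forall beta, Uhat beta i j m <= u 0 beta <= Util beta i j m) ->
     df D alpha alpha (pt D i j, tm D m) u <= K /\
     - df D alpha alpha' (pt D i j, tm D m) u <= 0) ->
  Uhat alpha i j m <= a -> a <= a' -> a' <= Util alpha i j m ->
  Uhat alpha' i j m <= b' -> b' <= b -> b <= Util alpha' i j m ->
  f D alpha (pt D i j, tm D m, uvec alpha a' b')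
    - f D alpha (pt D i j, tm D m, uvec alpha a b) <= K * (a' - a).
Proof.
move=> alphaN m_lev ij_mesh df_bound ha aa ha' hb' bb hb.
have mN : (m <= Nt D)%N by case/andP: m_lev.
pose h w := f D alpha (pt D i j, tm D m, w).
have in_sector (x y : R) : Uhat alpha i j m <= x <= Util alpha i j m ->
    Uhat alpha' i j m <= y <= Util alpha' i j m ->
    forall beta, Uhat beta i j m <= uvec alpha x y 0 beta <= Util beta i j m.
  move=> xin yin beta; rewrite mxE; have [->|->] := index2_cases beta alphaN.
    by rewrite eqxx.
  by rewrite eq_sym (negbTE alphaN).
have own : h (uvec alpha a b' + (a' - a) *: delta_mx 0 alpha)
    - h (uvec alpha a b') <= K * (a' - a).
  apply: le_increment_along_line => [|s]; first by rewrite subr_ge0.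
  move=> /andP[s0 s1]; split; first exact: f_derivable.
  apply: (df_bound _ _).1; rewrite uvec_own.
  by apply: in_sector; apply/andP; split; lra.
(* The mean value bound runs upwards, here from b' to b, and bounds increments
   from above; the lower bound on that increment is one for - h. *)
have other : - h (uvec alpha a b' + (b - b') *: delta_mx 0 alpha')
    - - h (uvec alpha a b') <= 0 * (b - b').
  apply: (@le_increment_along_line _ _ (- h)) => [|s].
    by rewrite subr_ge0.
  move=> /andP[s0 s1].
  have dh : derivable h (uvec alpha a b' + s *: delta_mx 0 alpha')
      (delta_mx 0 alpha') by exact: f_derivable.
  split; first exact: derivableN.
  rewrite deriveN//; apply: (df_bound _ _).2; rewrite uvec_other//.
  by apply: in_sector; apply/andP; split; lra.
rewrite uvec_own in own; rewrite uvec_other// in other.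
move: own other; rewrite ![_ + (_ - _)]addrC !subrK /h; lra.
Qed.

(** * The block operators *)

Lemma block_index_interior i (k : 'I_N) :
  (0 < i < Nx D)%N -> in_interior D i k.+1.
Proof. by move=> iN; rewrite /in_interior iN /=; have := ltn_ord k; lia. Qed.

Lemma block_index_mesh i (k : 'I_N) : (i <= Nx D)%N -> in_mesh D i k.+1.
Proof. by move=> iN; rewrite /in_mesh iN /=; have := ltn_ord k; lia. Qed.

Lemma coef_ge0 alpha i j m : in_mesh D i j -> (m <= Nt D)%N ->
  [/\ 0 <= lcoef D alpha i j m, 0 <= rcoef D alpha i j m,
      0 <= bcoef D alpha i j m & 0 <= tcoef D alpha i j m].
Proof.
move=> ij mN; have zQ := mesh_QT_bar ij mN.
have [v1p v2p] := (v1_ge0 alpha zQ, v2_ge0 alpha zQ).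
have [[ep hxp] hyp] := (ltW (eps_gt0 D alpha), hx_gt0, hy_gt0).
rewrite /lcoef /rcoef /bcoef /tcoef.
by split; rewrite ?addr_ge0// divr_ge0 ?exprn_ge0// ltW.
Qed.

Lemma sum_ord_at (a n : nat) (x : R) :
  \sum_(k < n) (if k == a :> nat then x else 0) = if (a < n)%N then x else 0.
Proof.
case: ltnP => [an|na].
  rewrite (bigD1 (Ordinal an)) //= eqxx big1 ?addr0// => k kan.
  by rewrite ifN// (contraNneq _ kan)// => /val_inj->.
by rewrite big1// => k _; rewrite ifN// neq_ltn (leq_trans (ltn_ord k)).
Qed.

(** The vector is given by a function [y] of the grid index j = k + 1, so that
    the three terms are the values at j, j - 1 and j + 1.  Neighbours outside
    the block contribute nothing: their boundary values sit in [Gstar].  Taking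
    [y] constant gives the row sums. *)
Lemma Amx_mul_entry alpha i m (y : nat -> R) (k : 'I_N) :
  (Amx D alpha i m *m (\col_k' y k'.+1 : 'cV[R]_N)) k 0 =
    dcoef D alpha i k.+1 m * y k.+1
    - bcoef D alpha i k.+1 m * (if k == 0%N :> nat then 0 else y k)
    - tcoef D alpha i k.+1 m * (if k.+1 == N then 0 else y k.+2).
Proof.
rewrite mxE.
(* Each of the three diagonals is met at most once; for k = 0 the truncated
   k.-1 names the main diagonal again, whence the zero coefficient there. *)
under eq_bigr => k' _.
  have -> : Amx D alpha i m k k' * (\col_k' y k'.+1 : 'cV[R]_N) k' 0 =
    (if k' == k :> nat then dcoef D alpha i k.+1 m * y k.+1 else 0)
    + (if k' == k.-1 :> nat then
        - bcoef D alpha i k.+1 m * (if k == 0%N :> nat then 0 else y k) else 0)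
    + (if k' == k.+1 :> nat then - tcoef D alpha i k.+1 m * y k.+2 else 0).
    rewrite !mxE -val_eqE /= [_ == k' :> nat]eq_sym.
    case: (eqVneq (k' : nat) k) => [->|kk].
      have -> : (k == k.+1 :> nat) = false by lia.
      have [k0|k0] := eqVneq (k : nat) 0%N.
        by rewrite mulr0 if_same !addr0.
      have -> : (k == k.-1 :> nat) = false by lia.
      by rewrite !addr0.
    rewrite add0r; have [kk'|kk'] := eqVneq (k : nat) k'.+1.
      have -> : (k' == k.-1 :> nat) by lia.
      have -> : (k == 0%N :> nat) = false by lia.
      have -> : (k' == k.+1 :> nat) = false by lia.
      by rewrite addr0 kk'.
    rewrite [_ == k' :> nat]eq_sym; have [k'k|k'k] := eqVneq (k' : nat) k.+1.
      have -> : (k' == k.-1 :> nat) = false by lia.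
      by rewrite add0r k'k.
    rewrite mul0r addr0; case: eqP => // k'p.
    have -> : (k == 0%N :> nat) by lia.
    by rewrite mulr0.
  over.
rewrite !big_split /= !sum_ord_at ltn_ord.
rewrite (leq_ltn_trans (leq_pred _) (ltn_ord k)).
rewrite !mulNr; congr (_ - _ + _).
have kN := ltn_ord k; have [kN'|kN'|kN'] := ltngtP k.+1 N => //; first by lia.
by rewrite mulr0 oppr0.
Qed.

Lemma Lmx_mul_entry alpha i m (x : 'cV[R]_N) k :
  (Lmx D alpha i m *m x) k 0 = lcoef D alpha i k.+1 m * x k 0.
Proof. by rewrite mul_diag_mx !mxE. Qed.

Lemma Rmx_mul_entry alpha i m (x : 'cV[R]_N) k :
  (Rmx D alpha i m *m x) k 0 = rcoef D alpha i k.+1 m * x k 0.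
Proof. by rewrite mul_diag_mx !mxE. Qed.

(** The linear operator that one iteration inverts: block Jacobi for [eta = 0],
    block Gauss-Seidel for [eta = 1]. *)
Definition sweep alpha m (eta cm : R) (Z : nat -> blockvec D) i : blockvec D :=
  Amx D alpha i m *m Z i - eta *: (Lmx D alpha i m *m Z i.-1) + cm *: Z i.

Lemma sweep_entry alpha m eta cm (Z : nat -> blockvec D) i k :
  sweep alpha m eta cm Z i k 0 = (Amx D alpha i m *m Z i) k 0
    - eta * (lcoef D alpha i k.+1 m * Z i.-1 k 0) + cm * Z i k 0.
Proof.
rewrite /sweep -Lmx_mul_entry.
move: (Amx D alpha i m *m Z i) (Lmx D alpha i m *m Z i.-1) => A L.
by rewrite !mxE.
Qed.

(** The row sums of A_i + c I are at least 1 / tau: the coefficients l and r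
    appear in the diagonal entry only, and b and t are cancelled at most by the
    off-diagonal entries. *)
Lemma block_solve_ge0 alpha i m (cm : R) (x : 'cV[R]_N) :
  (0 < i < Nx D)%N -> (m <= Nt D)%N -> 0 <= cm ->
  (forall k, 0 <= (Amx D alpha i m *m x + cm *: x) k 0) ->
  forall k, 0 <= x k 0.
Proof.
move=> iN mN cm0 Ax0.
have iN' : (i <= Nx D)%N by lia.
apply: (@Mmatrix_inverse_positive _ _ (Amx D alpha i m + cm%:M))
  => [k k' kk'|k|k]; last by rewrite mulmxDl mul_scalar_mx.
- have [_ _ b0 t0] := coef_ge0 alpha (block_index_mesh k iN') mN.
  rewrite !mxE (negbTE kk') mulr0n addr0.
  by case: ifP => _; [|case: ifP => _]; rewrite ?oppr_le0.
- have [l0 r0 b0 t0] := coef_ge0 alpha (block_index_mesh k iN') mN.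
  have -> : const_mx 1 = \col_(k' < N) (fun=> 1) k'.+1 :> 'cV[R]_N.
    by apply/colP => k'; rewrite !mxE.
  rewrite mulmxDl mul_scalar_mx mxE
    (Amx_mul_entry alpha i m (fun=> 1)) !mxE /dcoef.
  have tau0 : 0 < (tau D)^-1 by rewrite invr_gt0 tau_gt0.
  by do 2![case: ifP => _]; lra.
Qed.

(** Block forward substitution: on line i the term eta L Z_(i-1) is already
    known to be nonnegative and moves to the right-hand side. *)
Lemma sweep_ge0 alpha m (eta cm : R) (Z : nat -> blockvec D) :
  (m <= Nt D)%N -> 0 <= cm -> 0 <= eta ->
  (forall i, i = 0%N \/ i = Nx D -> lev 0 (Z i)) ->
  (forall i, (0 < i < Nx D)%N -> lev 0 (sweep alpha m eta cm Z i)) ->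
  forall i, (i <= Nx D)%N -> lev 0 (Z i).
Proof.
move=> mN cm0 eta0 Zb Zi; elim=> [|i IHi] iN; first by apply: Zb; left.
have [->|iN'] := eqVneq i.+1 (Nx D); first by apply: Zb; right.
have iI : (0 < i.+1 < Nx D)%N by lia.
move=> k; rewrite mxE; move: k.
apply: (@block_solve_ge0 alpha i.+1 m cm) => // k.
have := Zi _ iI k; have := IHi (ltnW iN) k.
have [l0 _ _ _] := coef_ge0 alpha (block_index_mesh k iN) mN.
rewrite [_ k 0]mxE sweep_entry /= => z0.
have : 0 <= eta * (lcoef D alpha i.+1 k.+1 m * Z i k 0) by rewrite !mulr_ge0.
have -> : (Amx D alpha i.+1 m *m Z i.+1 + cm *: Z i.+1) k 0 =
    (Amx D alpha i.+1 m *m Z i.+1) k 0 + cm * Z i.+1 k 0.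
  by move: (Amx D alpha i.+1 m *m Z i.+1) => A; rewrite !mxE.
by lra.
Qed.

Lemma lev_trans (X Y Z : blockvec D) : lev X Y -> lev Y Z -> lev X Z.
Proof. by move=> XY YZ k; apply: le_trans (XY k) (YZ k). Qed.

(** * The residual *)

Lemma residual_entry alpha i m V P W k :
  residual alpha i m V P W k 0 =
    (Amx D alpha i m *m V i) k 0 - lcoef D alpha i k.+1 m * V i.-1 k 0
    - rcoef D alpha i k.+1 m * V i.+1 k 0
    + f D alpha (pt D i k.+1, tm D m, uvec alpha (V i k 0) (W k 0))
    - (tau D)^-1 * P k 0 + Gstar D alpha i m k 0.
Proof.
rewrite /residual -Lmx_mul_entry -Rmx_mul_entry.
move: (Amx D alpha i m *m V i) (Lmx D alpha i m *m V i.-1)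
  (Rmx D alpha i m *m V i.+1) (Gstar D alpha i m) => A L Q G.
by rewrite !mxE.
Qed.

(** [Gstar] cancels in differences, so the prescribed boundary values at y_0 and
    y_Ny matter only for the initial iterate. *)
Lemma residual_difference alpha i m V V' P P' W W' k :
  residual alpha i m V' P' W' k 0 - residual alpha i m V P W k 0 =
    (Amx D alpha i m *m (V' i - V i)) k 0
    - lcoef D alpha i k.+1 m * (V' i.-1 k 0 - V i.-1 k 0)
    - rcoef D alpha i k.+1 m * (V' i.+1 k 0 - V i.+1 k 0)
    + (f D alpha (pt D i k.+1, tm D m, uvec alpha (V' i k 0) (W' k 0))
       - f D alpha (pt D i k.+1, tm D m, uvec alpha (V i k 0) (W k 0)))
    - (tau D)^-1 * (P' k 0 - P k 0).
Proof.
rewrite !residual_entry mulmxBr.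
move: (Amx D alpha i m *m V' i) (Amx D alpha i m *m V i) => A' A.
by rewrite [(A' - A) k 0]mxE [(- A) k 0]mxE; ring.
Qed.

(** The residual on a line differs from the difference scheme in that it uses
    the computed values of the previous level and the prescribed boundary
    values at y_0 and y_Ny; each replacement leaves a defect term. *)
Lemma residual_block alpha alpha' i m (V W : mesh_fun R) P (k : 'I_N) :
  (0 < i < Nx D)%N ->
  residual alpha i m (fun i' => block D V alpha i' m) P
    (block D W alpha' i m) k 0
  = scheme_lhs D alpha alpha' i k.+1 m V W
    + (tau D)^-1 * (V alpha i k.+1 m.-1 - P k 0)
    + (if k == 0%N :> nat then bcoef D alpha i k.+1 m *
         (V alpha i 0%N m - g D alpha (pt D i 0, tm D m)) else 0)
    + (if k.+1 == N then tcoef D alpha i k.+1 m *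
         (V alpha i (Ny D) m - g D alpha (pt D i (Ny D), tm D m)) else 0).
Proof.
move=> /andP[i0 _]; rewrite residual_entry.
rewrite (Amx_mul_entry alpha i m (fun j => V alpha i j m)).
have NyE : (Ny D = N.+1)%N by have := Ny_gt0 D; lia.
rewrite !mxE eqSS /scheme_lhs /Lh /Dxx /Dyy /Dx /Dy /dcoef /lcoef /rcoef /tcoef.
rewrite /bcoef /=.
have [kN|_] := eqVneq k.+1 N.
  have -> : k.+2 = Ny D by lia.
  by have [->|_] := eqVneq (k : nat) 0%N; ring.
by have [->|_] := eqVneq (k : nat) 0%N; ring.
Qed.

Lemma residual_block_ge0 alpha alpha' i m (V W : mesh_fun R) P :
  (0 < i < Nx D)%N -> (m <= Nt D)%N ->
  (forall j, in_interior D i j -> 0 <= scheme_lhs D alpha alpha' i j m V W) ->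
  (forall j, on_boundary D i j ->
     g D alpha (pt D i j, tm D m) <= V alpha i j m) ->
  lev P (block D V alpha i m.-1) ->
  lev 0 (residual alpha i m (fun i' => block D V alpha i' m) P
           (block D W alpha' i m)).
Proof.
move=> iN mN lhs0 gV PV k; rewrite residual_block// [_ k 0]mxE.
have iN' : (i <= Nx D)%N by lia.
have [_ _ b0 t0] := coef_ge0 alpha (block_index_mesh k iN') mN.
have PVk := PV k; rewrite mxE in PVk.
have bnd0 : on_boundary D i 0.
  by rewrite /on_boundary /in_mesh /in_interior; lia.
have bndN : on_boundary D i (Ny D).
  by rewrite /on_boundary /in_mesh /in_interior; lia.
apply: addr_ge0; first apply: addr_ge0; first apply: addr_ge0.
- by apply: lhs0; apply: block_index_interior.
- by rewrite mulr_ge0 ?subr_ge0// invr_ge0 ltW ?tau_gt0.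
- by case: ifP => // _; rewrite mulr_ge0// subr_ge0 gV.
- by case: ifP => // _; rewrite mulr_ge0// subr_ge0 gV.
Qed.

Lemma residual_block_le0 alpha alpha' i m (V W : mesh_fun R) P :
  (0 < i < Nx D)%N -> (m <= Nt D)%N ->
  (forall j, in_interior D i j -> scheme_lhs D alpha alpha' i j m V W <= 0) ->
  (forall j, on_boundary D i j ->
     V alpha i j m <= g D alpha (pt D i j, tm D m)) ->
  lev (block D V alpha i m.-1) P ->
  lev (residual alpha i m (fun i' => block D V alpha i' m) P
         (block D W alpha' i m)) 0.
Proof.
move=> iN mN lhs0 gV PV k; rewrite residual_block// [leRHS]mxE.
have iN' : (i <= Nx D)%N by lia.
have [_ _ b0 t0] := coef_ge0 alpha (block_index_mesh k iN') mN.
have PVk := PV k; rewrite mxE in PVk.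
have bnd0 : on_boundary D i 0.
  by rewrite /on_boundary /in_mesh /in_interior; lia.
have bndN : on_boundary D i (Ny D).
  by rewrite /on_boundary /in_mesh /in_interior; lia.
rewrite -[leRHS]addr0 lerD//; last first.
  by case: ifP => // _; rewrite mulr_ge0_le0// subr_le0 gV.
rewrite -[leRHS]addr0 lerD//; last first.
  by case: ifP => // _; rewrite mulr_ge0_le0// subr_le0 gV.
rewrite -[leRHS]addr0 lerD ?lhs0 ?block_index_interior//.
by rewrite mulr_ge0_le0 ?subr_le0// invr_ge0 ltW ?tau_gt0.
Qed.

Lemma sweepD alpha m eta cm (V V' : nat -> blockvec D) i :
  sweep alpha m eta cm (fun k => V k + V' k) i =
  sweep alpha m eta cm V i + sweep alpha m eta cm V' i.
Proof.
rewrite /sweep !mulmxDr !scalerDr.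
by rewrite opprD [X in X + (cm *: _ + _) = _]addrACA [LHS]addrACA.
Qed.

Lemma sweepN alpha m eta cm (V : nat -> blockvec D) i :
  sweep alpha m eta cm (fun k => - V k) i = - sweep alpha m eta cm V i.
Proof. by rewrite /sweep !mulmxN !scalerN !opprD. Qed.

(** The equation for [Z] trades A Z for the old residual, which cancels.  What
    remains is the linearisation error of the reaction term and the couplings
    that the sweep treats explicitly: the line i + 1 always, the line i - 1 for
    block Jacobi only. *)
Lemma residual_after_sweep alpha i m eta cm V V' Z P W W' (k : 'I_N) :
  (0 < i < Nx D)%N -> (forall j, (j <= Nx D)%N -> V' j = V j + Z j) ->
  sweep alpha m eta cm Z i = - residual alpha i m V P W ->
  residual alpha i m V' P W' k 0 =
    (f D alpha (pt D i k.+1, tm D m, uvec alpha (V' i k 0) (W' k 0))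
     - f D alpha (pt D i k.+1, tm D m, uvec alpha (V i k 0) (W k 0)))
    - cm * (V' i k 0 - V i k 0)
    - (1 - eta) * (lcoef D alpha i k.+1 m * (V' i.-1 k 0 - V i.-1 k 0))
    - rcoef D alpha i k.+1 m * (V' i.+1 k 0 - V i.+1 k 0).
Proof.
move=> iN V'E sweepE.
have ZE j : (j <= Nx D)%N -> V' j - V j = Z j.
  by move=> /V'E ->; rewrite addrC addKr.
have ZkE j : (j <= Nx D)%N -> Z j k 0 = V' j k 0 - V j k 0.
  by move=> /ZE <-; rewrite !mxE.
have := residual_difference alpha i m V V' P P W W' k.
have := sweep_entry alpha m eta cm Z i k; rewrite sweepE.
have oppE (X : blockvec D) : (- X) k 0 = - X k 0 by rewrite mxE.
rewrite oppE ZE ?ZkE; try lia.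
by lra.
Qed.

End Scheme.

(** * Induction over iterations and time levels *)

Section Iteration.
Variables (R : realType) (D : problem R) (Util Uhat c : mesh_fun R) (eta : R).
Variables (nit : nat -> nat) (Ubar Zbar Ulow Zlow : iterates D).
Implicit Types (alpha beta : 'I_2) (i j m n : nat).
Local Notation N := ((Ny D).-1).

Hypothesis ordered : ordered_upper_lower D Util Uhat.
Hypothesis c_ge0 : forall alpha i j m,
  time_level D m -> in_mesh D i j -> 0 <= c alpha i j m.
Hypothesis df_bounds : forall m i j alpha alpha' (u : 'rV[R]_2),
  time_level D m -> in_mesh D i j -> alpha != alpha' ->
  (forall beta, Uhat beta i j m <= u 0 beta <= Util beta i j m) ->
  df D alpha alpha (pt D i j, tm D m) u <= c alpha i j m /\
  - df D alpha alpha' (pt D i j, tm D m) u <= 0.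
(* Only the signs of eta and 1 - eta enter, so that block Jacobi and block
   Gauss-Seidel are treated at once. *)
Hypothesis eta01 : 0 <= eta <= 1.
Hypothesis method : coupled_block_method c eta nit Ubar Zbar Ulow Zlow.
Hypothesis start : forall alpha i m, time_level D m -> (i <= Nx D)%N ->
  Ubar alpha i m 0%N = block D Util alpha i m /\
  Ulow alpha i m 0%N = block D Uhat alpha i m.

Definition sandwiched m (L U : 'I_2 -> nat -> blockvec D) : Prop :=
  forall alpha i, (i <= Nx D)%N ->
  [/\ lev (block D Uhat alpha i m) (L alpha i), lev (L alpha i) (U alpha i) &
      lev (U alpha i) (block D Util alpha i m)].

Definition residual_signs m n : Prop :=
  forall alpha alpha' i, alpha != alpha' -> (0 < i < Nx D)%N ->
  lev 0 (residual alpha i m (fun k => Ubar alpha k m n)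
           (level_sol nit Ubar alpha i m.-1) (Ulow alpha' i m n)) /\
  lev (residual alpha i m (fun k => Ulow alpha k m n)
         (level_sol nit Ulow alpha i m.-1) (Ubar alpha' i m n)) 0.

Definition monotone_step m n : Prop :=
  forall alpha i, (i <= Nx D)%N ->
  lev (Ulow alpha i m n) (Ulow alpha i m n.+1) /\
  lev (Ubar alpha i m n.+1) (Ubar alpha i m n).

Definition iterates_sandwiched m n : Prop :=
  sandwiched m (fun alpha i => Ulow alpha i m n)
    (fun alpha i => Ubar alpha i m n).

Definition previous_sandwiched m : Prop :=
  sandwiched m.-1 (fun alpha i => level_sol nit Ulow alpha i m.-1)
    (fun alpha i => level_sol nit Ubar alpha i m.-1).

Lemma exists_other_index alpha : exists alpha', alpha != alpha'.
Proof.
by case: alpha => [[|[|//]] ?]; [exists ord_max | exists ord0].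
Qed.

Lemma cmax_ge0 alpha m : time_level D m -> 0 <= cmax D c alpha m.
Proof.
move=> mlev; have mesh0 : in_mesh D 0 0 by [].
exact: le_trans (c_ge0 alpha mlev mesh0) (le_cmax c alpha m mesh0).
Qed.

(** All later estimates of the nonlinearity are instances of this one: upper
    against lower iterate, new lower against old lower, and old upper against
    new upper, the other component moving the opposite way each time. *)
Lemma reaction_increment_le m alpha alpha' i (a a' b b' : blockvec D)
    (k : 'I_N) :
  alpha != alpha' -> time_level D m -> (i <= Nx D)%N ->
  lev (block D Uhat alpha i m) a -> lev a a' ->
  lev a' (block D Util alpha i m) ->
  lev (block D Uhat alpha' i m) b' -> lev b' b ->
  lev b (block D Util alpha' i m) ->
  f D alpha (pt D i k.+1, tm D m, uvec alpha (a' k 0) (b' k 0))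
    - f D alpha (pt D i k.+1, tm D m, uvec alpha (a k 0) (b k 0))
  <= cmax D c alpha m * (a' k 0 - a k 0).
Proof.
move=> alphaN mlev iN /(_ k) + /(_ k) aa' /(_ k) + /(_ k) + /(_ k) bb' /(_ k).
rewrite !mxE => ha ha' hb' hb.
have ij := block_index_mesh k iN.
apply: (f_increment_le alphaN mlev ij _ ha aa' ha' hb' bb' hb) => u u_in.
have [own other] := df_bounds mlev ij alphaN u_in.
by split=> //; apply: le_trans own (le_cmax _ _ _ ij).
Qed.

Lemma boundary_lines_sandwich alpha i (k : 'I_N) m : time_level D m ->
  i = 0%N \/ i = Nx D ->
  block D Uhat alpha i m k 0 <= gblock D alpha i m k 0
    <= block D Util alpha i m k 0.
Proof.
move=> mlev iB; rewrite !mxE; have [_ _ bnd _] := ordered.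
apply: bnd => //; rewrite /on_boundary block_index_mesh /=; last by lia.
by rewrite /in_interior; lia.
Qed.

(** The given upper solution dominates the boundary data and the computed
    solution of the previous level, so the three defects in [residual_block]
    reinforce the inequality for the scheme. *)
Lemma initial_residual_signs m : time_level D m -> previous_sandwiched m ->
  residual_signs m 0.
Proof.
move=> mlev prev alpha alpha' i alphaN iN.
have iN' : (i <= Nx D)%N by lia.
have mN : (m <= Nt D)%N by case/andP: mlev.
have [_ lhs bnd _] := ordered.
have [lowP _ barP] := prev alpha i iN'.
have startbar beta k : (k <= Nx D)%N ->
    Ubar beta k m 0%N = block D Util beta k m.
  by move=> kN; case: (start beta mlev kN).
have startlow beta k : (k <= Nx D)%N ->
    Ulow beta k m 0%N = block D Uhat beta k m.
  by move=> kN; case: (start beta mlev kN).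
rewrite /residual !startbar ?startlow; try lia.
split.
- apply: residual_block_ge0 => // j ij.
    by case: (lhs _ _ i j m alphaN mlev ij).
  by case/andP: (bnd alpha i j m mlev ij).
- apply: residual_block_le0 => // j ij.
    by case: (lhs _ _ i j m alphaN mlev ij).
  by case/andP: (bnd alpha i j m mlev ij).
Qed.

(** The corrections solve sweep equations with right-hand sides minus the
    residuals.  On the boundary lines they lead from the sector to the data g
    at the first iteration, and vanish later. *)
Lemma corrections_monotone m n : time_level D m -> residual_signs m n ->
  monotone_step m n.
Proof.
move=> mlev signs alpha i iN.
have mN : (m <= Nt D)%N by case/andP: mlev.
have cm0 := cmax_ge0 alpha mlev.
have [eta0 _] := andP eta01.
have [alpha' alphaN] := exists_other_index alpha.
have [barE lowE] := method alphaN.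
have [barD bar_sweep bar_bnd] := barE m n.+1 mlev isT.
have [lowD low_sweep low_bnd] := lowE m n.+1 mlev isT.
have low_ge0 : lev 0 (Zlow alpha i m n.+1).
  apply: (@sweep_ge0 _ _ alpha m eta (cmax D c alpha m)
    (fun i' => Zlow alpha i' m n.+1)) => // i' iB k.
    have iN' : (i' <= Nx D)%N by lia.
    rewrite low_bnd// [_ k 0]mxE; case: ifP => _; last by rewrite mxE.
    have [_ ->] := start alpha mlev iN'.
    have /andP[+ _] := boundary_lines_sandwich alpha k mlev iB.
    by rewrite !mxE subr_ge0.
  rewrite /sweep low_sweep// [_ k 0]mxE.
  have [_ /(_ k)] := signs alpha alpha' i' alphaN iB.
  by rewrite [leRHS]mxE [X in _ -> _ <= X]mxE oppr_ge0.
have bar_le0 : lev 0 (- Zbar alpha i m n.+1).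
  apply: (@sweep_ge0 _ _ alpha m eta (cmax D c alpha m)
    (fun i' => - Zbar alpha i' m n.+1)) => // i' iB k.
    have iN' : (i' <= Nx D)%N by lia.
    rewrite bar_bnd// [_ k 0]mxE; case: ifP => _; last by rewrite oppr0 mxE.
    have [-> _] := start alpha mlev iN'.
    have /andP[_ +] := boundary_lines_sandwich alpha k mlev iB.
    by rewrite !mxE oppr_ge0 subr_le0.
  rewrite sweepN /sweep bar_sweep// opprK [_ k 0]mxE.
  have [/(_ k) + _] := signs alpha alpha' i' alphaN iB.
  by rewrite [leLHS]mxE.
split=> k; have := low_ge0 k; have := bar_le0 k.
  by rewrite lowD// !mxE; lra.
by rewrite barD// !mxE; lra.
Qed.

(** The minimum principle applied to the gap between the new iterates.  On the
    boundary lines this gap is zero after the first iteration, both iterates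
    being equal to g there, and does not change later. *)
Lemma iterates_ordered m n : time_level D m -> previous_sandwiched m ->
  iterates_sandwiched m n ->
  forall alpha i, (i <= Nx D)%N ->
  lev (Ulow alpha i m n.+1) (Ubar alpha i m n.+1).
Proof.
move=> mlev prev sand alpha.
have mN : (m <= Nt D)%N by case/andP: mlev.
have cm0 := cmax_ge0 alpha mlev.
have [eta0 eta1] := andP eta01.
have [alpha' alphaN] := exists_other_index alpha.
have [barE lowE] := method alphaN.
have [barD bar_sweep bar_bnd] := barE m n.+1 mlev isT.
have [lowD low_sweep low_bnd] := lowE m n.+1 mlev isT.
pose gap i := Ubar alpha i m n.+1 - Ulow alpha i m n.+1.
suff gap_ge0 i : (i <= Nx D)%N -> lev 0 (gap i).
  by move=> i iN k; have := gap_ge0 i iN k; rewrite !mxE subr_ge0.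
have boundary_ge0 i' : i' = 0%N \/ i' = Nx D -> lev 0 (gap i').
  move=> iB k; have iN : (i' <= Nx D)%N by lia.
  rewrite /gap lowD// barD// low_bnd// bar_bnd//=.
  have [_ /(_ k) ord _] := sand alpha i' iN.
  case: eqP => [n0|_]; last by rewrite !mxE; lra.
  have -> : n = 0%N by lia.
  by rewrite !mxE; lra.
apply: (@sweep_ge0 _ _ alpha m eta (cmax D c alpha m) gap) => // i' iI k.
have iN : (i' <= Nx D)%N by lia.
have iN1 : (i'.-1 <= Nx D)%N by lia.
have iN2 : (i'.+1 <= Nx D)%N by lia.
have [l0 r0 _ _] := coef_ge0 alpha (block_index_mesh k iN) mN.
pose U i := Ubar alpha i m n; pose L i := Ulow alpha i m n.
have sweep_bar : sweep alpha m eta (cmax D c alpha m)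
    (fun i => Zbar alpha i m n.+1) i' = - residual alpha i' m U
      (level_sol nit Ubar alpha i' m.-1) (Ulow alpha' i' m n).
  exact: bar_sweep.
have sweep_low : sweep alpha m eta (cmax D c alpha m)
    (fun i => Zlow alpha i m n.+1) i' = - residual alpha i' m L
      (level_sol nit Ulow alpha i' m.-1) (Ubar alpha' i' m n).
  exact: low_sweep.
have gapE j : (j <= Nx D)%N -> gap j =
    (U j + - L j) + (Zbar alpha j m n.+1 + - Zlow alpha j m n.+1).
  by move=> jN; rewrite /gap lowD// barD//= opprD addrACA.
have -> : sweep alpha m eta (cmax D c alpha m) gap i' =
    sweep alpha m eta (cmax D c alpha m) (fun j => (U j + - L j)
      + (Zbar alpha j m n.+1 + - Zlow alpha j m n.+1)) i'.
  by rewrite /sweep !gapE.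
rewrite sweepD [X in _ + X]sweepD sweepN sweep_bar sweep_low opprK.
(* A applied to the old gap occurs both in its sweep and in the difference of
   the residuals, and drops out. *)
have diff := residual_difference alpha i' m L U
  (level_sol nit Ulow alpha i' m.-1) (level_sol nit Ubar alpha i' m.-1)
  (Ubar alpha' i' m n) (Ulow alpha' i' m n) k.
have entryE (X Y Q : blockvec D) :
    (X + (- Y + Q)) k 0 = X k 0 - (Y k 0 - Q k 0).
  by rewrite !mxE; ring.
rewrite entryE diff sweep_entry [_ k 0]mxE.
have gap_entry j : (U j + - L j) k 0 = U j k 0 - L j k 0 by rewrite !mxE.
rewrite !gap_entry.
have [lowa orda bara] := sand alpha i' iN.
have [lowb ordb barb] := sand alpha' i' iN.
have reaction := reaction_increment_le k alphaN mlev iN lowa orda bara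
  lowb ordb barb.
have [_ /(_ k) ord1 _] := sand alpha i'.-1 iN1.
have [_ /(_ k) ord2 _] := sand alpha i'.+1 iN2.
have [_ /(_ k) ordp _] := prev alpha i' iN.
have left_ge0 : 0 <= (1 - eta) * (lcoef D alpha i' k.+1 m
    * (U i'.-1 k 0 - L i'.-1 k 0)).
  by rewrite !mulr_ge0 ?subr_ge0.
have right_ge0 : 0 <= rcoef D alpha i' k.+1 m * (U i'.+1 k 0 - L i'.+1 k 0).
  by rewrite mulr_ge0 ?subr_ge0.
have prev_ge0 : 0 <= (tau D)^-1 * (level_sol nit Ubar alpha i' m.-1 k 0
    - level_sol nit Ulow alpha i' m.-1 k 0).
  by rewrite mulr_ge0 ?subr_ge0// invr_ge0 ltW ?tau_gt0.
rewrite -/(U i') -/(L i') in reaction.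
move: left_ge0 right_ge0 prev_ge0 reaction; lra.
Qed.

Lemma residual_signs_step m n : time_level D m ->
  iterates_sandwiched m n -> iterates_sandwiched m n.+1 ->
  monotone_step m n -> residual_signs m n.+1.
Proof.
move=> mlev sand sand' step alpha alpha' i alphaN iI.
have iN : (i <= Nx D)%N by lia.
have iN1 : (i.-1 <= Nx D)%N by lia.
have iN2 : (i.+1 <= Nx D)%N by lia.
have mN : (m <= Nt D)%N by case/andP: mlev.
have eta1 : 0 <= 1 - eta by rewrite subr_ge0; case/andP: eta01.
have [barE lowE] := method alphaN.
have [barD bar_sweep _] := barE m n.+1 mlev isT.
have [lowD low_sweep _] := lowE m n.+1 mlev isT.
have [lowa _ bara] := sand alpha i iN.
have [lowb _ barb] := sand alpha' i iN.
have [lowa' mida' bara'] := sand' alpha i iN.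
have [lowb' midb' barb'] := sand' alpha' i iN.
split=> k; have [l0 r0 _ _] := coef_ge0 alpha (block_index_mesh k iN) mN.
- rewrite (residual_after_sweep (V' := fun j => Ubar alpha j m n.+1)
    (V := fun j => Ubar alpha j m n) (Z := fun j => Zbar alpha j m n.+1)
    _ k iI barD (bar_sweep i iI)) [leLHS]mxE.
  have bar_le j : (j <= Nx D)%N ->
      0 <= Ubar alpha j m n k 0 - Ubar alpha j m n.+1 k 0.
    by move=> jN; rewrite subr_ge0; have [_] := step alpha j jN; apply.
  have reaction := reaction_increment_le k alphaN mlev iN
    (lev_trans lowa' mida') (step alpha i iN).2 bara
    lowb (step alpha' i iN).1 (lev_trans midb' barb').
  have left_ge0 := mulr_ge0 (mulr_ge0 eta1 l0) (bar_le _ iN1).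
  have right_ge0 := mulr_ge0 r0 (bar_le _ iN2).
  move: left_ge0 right_ge0 reaction; lra.
- rewrite (residual_after_sweep (V' := fun j => Ulow alpha j m n.+1)
    (V := fun j => Ulow alpha j m n) (Z := fun j => Zlow alpha j m n.+1)
    _ k iI lowD (low_sweep i iI)) [leRHS]mxE.
  have low_ge j : (j <= Nx D)%N ->
      0 <= Ulow alpha j m n.+1 k 0 - Ulow alpha j m n k 0.
    by move=> jN; rewrite subr_ge0; have [+ _] := step alpha j jN; apply.
  have reaction := reaction_increment_le k alphaN mlev iN
    lowa (step alpha i iN).1 (lev_trans mida' bara')
    (lev_trans lowb' midb') (step alpha' i iN).2 barb.
  have left_ge0 := mulr_ge0 (mulr_ge0 eta1 l0) (low_ge _ iN1).
  have right_ge0 := mulr_ge0 r0 (low_ge _ iN2).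
  move: left_ge0 right_ge0 reaction; lra.
Qed.

(** The three properties are proved together: signs at n give monotonicity from
    n to n + 1, this and the ordering give the sandwich at n + 1, and the two
    sandwiches and the monotonicity give the signs at n + 1. *)
Lemma level_iteration m n : time_level D m -> previous_sandwiched m ->
  [/\ iterates_sandwiched m n, residual_signs m n & monotone_step m n].
Proof.
move=> mlev prev; elim: n => [|n [sand signs step]].
  have sand : iterates_sandwiched m 0.
    move=> alpha i iN; have [-> ->] := start alpha mlev iN; split=> // k.
    rewrite !mxE; have [ord _ _ _] := ordered.
    exact: ord (block_index_mesh k iN).
  have signs := initial_residual_signs mlev prev.
  by split=> //; apply: corrections_monotone.
have sand' : iterates_sandwiched m n.+1.
  move=> alpha i iN; have [lowU _ Ubar_le] := sand alpha i iN.
  have [low_le bar_le] := step alpha i iN.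
  split; [exact: lev_trans lowU low_le | exact: iterates_ordered |].
  exact: lev_trans bar_le Ubar_le.
have signs' := residual_signs_step mlev sand sand' step.
by split=> //; apply: corrections_monotone.
Qed.

Lemma all_previous_sandwiched m : time_level D m -> previous_sandwiched m.
Proof.
case: m => // m; rewrite /previous_sandwiched /=.
elim: m => [|m IHm] mlev.
  move=> alpha i iN /=; have [_ _ _ ini] := ordered.
  by split=> k; rewrite ?mxE//;
    have /andP[] := ini alpha _ _ (block_index_mesh k iN).
have mlev' : time_level D m.+1 by move: mlev; rewrite /time_level; lia.
by have [] := level_iteration (nit m.+1) mlev' (IHm mlev').
Qed.

End Iteration.

Theorem theorem10 (R : realType) (D : problem R)
    (Util Uhat c : mesh_fun R) (eta : R) (nit : nat -> nat)
    (Ubar Zbar Ulow Zlow : iterates D) :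
  ordered_upper_lower D Util Uhat ->
  (forall alpha i j m, time_level D m -> in_mesh D i j -> 0 <= c alpha i j m) ->
  (exists M : R, forall alpha i j m, time_level D m -> in_mesh D i j ->
    c alpha i j m <= M) ->
  (forall m i j (alpha alpha' : 'I_2) (u : 'rV[R]_2),
    time_level D m -> in_mesh D i j -> alpha != alpha' ->
    (forall beta, Uhat beta i j m <= u 0 beta <= Util beta i j m) ->
    df D alpha alpha (pt D i j, tm D m) u <= c alpha i j m /\
    - df D alpha alpha' (pt D i j, tm D m) u <= 0) ->
  eta = 0 \/ eta = 1 ->
  (forall m, time_level D m -> (1 <= nit m)%N) ->
  coupled_block_method c eta nit Ubar Zbar Ulow Zlow ->
  (forall alpha i m, time_level D m -> (i <= Nx D)%N ->
    Ubar alpha i m 0%N = block D Util alpha i m /\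
    Ulow alpha i m 0%N = block D Uhat alpha i m) ->
  [/\ forall n m (alpha alpha' : 'I_2) i, (1 <= n)%N -> time_level D m ->
        alpha != alpha' -> (0 < i < Nx D)%N ->
        lev 0 (residual alpha i m (fun k => Ubar alpha k m n)
                 (level_sol nit Ubar alpha i m.-1) (Ulow alpha' i m n)) /\
        lev (residual alpha i m (fun k => Ulow alpha k m n)
               (level_sol nit Ulow alpha i m.-1) (Ubar alpha' i m n)) 0,
      forall n m alpha i, (1 <= n)%N -> time_level D m -> (i <= Nx D)%N ->
        lev (Ulow alpha i m n) (Ubar alpha i m n),
      forall m alpha i, time_level D m -> (i <= Nx D)%N ->
        cvgn (Ubar alpha i m) /\ cvgn (Ulow alpha i m) &
      forall n m alpha i, (1 <= n)%N -> time_level D m -> (i <= Nx D)%N ->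
        [/\ lev (Ulow alpha i m n.-1) (Ulow alpha i m n),
            lev (Ulow alpha i m n) (Ubar alpha i m n) &
            lev (Ubar alpha i m n) (Ubar alpha i m n.-1)]].
Proof.
move=> ordered c_ge0 _ df_bounds eta01 _ method start.
have eta_in : 0 <= eta <= 1 by case: eta01 => ->; rewrite lexx ler01.
have all_n m n (mlev : time_level D m) :=
  level_iteration ordered c_ge0 df_bounds eta_in method start n mlev
    (all_previous_sandwiched ordered c_ge0 df_bounds eta_in method start mlev).
split.
- move=> n m alpha alpha' i _ mlev alphaN iI.
  by have [_ signs _] := all_n m n mlev; apply: signs.
- move=> n m alpha i _ mlev iN.
  by have [sand _ _] := all_n m n mlev; have [] := sand alpha i iN.
- move=> m alpha i mlev iN.
  have bounds n : lev (block D Uhat alpha i m) (Ubar alpha i m n) /\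
      lev (Ulow alpha i m n) (block D Util alpha i m).
    have [/(_ alpha i iN)[lowU ord barU] _ _] := all_n m n mlev.
    by split; [exact: lev_trans lowU ord | exact: lev_trans ord barU].
  split; apply: is_cvgn_mx => k j; rewrite ord1 {j}.
    apply: nonincreasing_is_cvgn.
      apply/nonincreasing_seqP => n; have [_ _ step] := all_n m n mlev.
      by have [_] := step alpha i iN; apply.
    exists (block D Uhat alpha i m k 0) => _ [n _ <-].
    by have [+ _] := bounds n; apply.
  apply: nondecreasing_is_cvgn.
    apply/nondecreasing_seqP => n; have [_ _ step] := all_n m n mlev.
    by have [+ _] := step alpha i iN; apply.
  exists (block D Util alpha i m k 0) => _ [n _ <-].
  by have [_] := bounds n; apply.
- move=> [//|n] m alpha i _ mlev iN.
  have [_ _ /(_ alpha i iN)[low_le bar_le]] := all_n m n mlev.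
  by have [/(_ alpha i iN)[_ ord _] _ _] := all_n m n.+1 mlev.
Qed.
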